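(* Let $n\ge 3$ be an integer, let $F$ be a field of characteristic $0$, and let $f:\mathcal H_n\rightarrow\mathcal H_n$ be an $F$-linear map satisfying $[f(X),X]=0$ for all $X\in\mathcal H_n$. Then there exist $A\in\mathcal C_n$, $B,C\in\mathcal P_n$, and an additive map $\zeta:\mathcal H_n\rightarrow Z(\mathcal H_n)$ such that $$f(X)=\{X,A\}+X^\tau B+CX^\tau+\zeta(X)$$ for all $X\in\mathcal H_n$.
   Context: $M_n(F)$ denotes the $n\times n$ matrices over $F$. $\mathcal H_n=\mathcal H_n(F)$ is the Heisenberg algebra: the set of all matrices $X=(x_{i,j})\in M_n(F)$ whose only possibly nonzero entries are $x_{1,j}$ for $2\le j\le n$ and $x_{i,n}$ for $1\le i\le n-1$ (i.e. the first row and last column, with $(1,1)$ and $(n,n)$ entries equal to $0$), with ordinary matrix operations. Its center is $Z(\mathcal H_n)=\{a e_{1,n}: a\in F\}$, where $e_{i,j}$ is the $n\times n$ matrix with $(i,j)$ entry $1$ and all other entries $0$. $[A,B]=AB-BA$ and $\{A,B\}=AB+BA$. For an $n\times n$ matrix $A=(a_{i,j})$, the anti-transpose $A^\tau$ is the matrix whose $(i,j)$ entry is $a_{n-j+1,n-i+1}$. $\mathcal C_n$ is the set of all matrices in $M_n(F)$ whose first row, first column, $n$-th row and $n$-th column are all zero. $\mathcal P_n=\{A\in \mathcal C_n : A=-A^\tau \text{ and } a_{i,n-i+1}=0 \text{ for all } 1\le i\le n\}$ (hollow, skew-persymmetric matrices in $\mathcal C_n$). *)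

(* Defs.v *)
From HB Require Import structures.
From mathcomp Require Import all_boot all_order all_algebra.

Set Implicit Arguments.
Unset Strict Implicit.
Unset Printing Implicit Defensive.

Import GRing.Theory.
Local Open Scope ring_scope.

Definition commutator (F : fieldType) (n : nat) (A B : 'M[F]_n) : 'M[F]_n :=
  A *m B - B *m A.

Definition anticommutator (F : fieldType) (n : nat) (A B : 'M[F]_n) : 'M[F]_n :=
  A *m B + B *m A.

(* Indices are 0-based: the position (n - j + 1, n - i + 1) of the 1-based
   convention is (rev_ord j, rev_ord i). *)
Definition antitr (F : fieldType) (n : nat) (A : 'M[F]_n) : 'M[F]_n :=
  \matrix_(i, j) A (rev_ord j) (rev_ord i).

(* In 1-based indices: i = 1 and 2 <= j, or j = n and i <= n - 1. *)
Definition heis_pos (n : nat) (i j : 'I_n) : bool :=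
  (i == 0%N :> nat) && (j != 0%N :> nat) || (j.+1 == n) && (i.+1 != n).

Definition heis_pred (F : fieldType) (n : nat) : {pred 'M[F]_n} :=
  fun X => [forall i, forall j, ~~ heis_pos i j ==> (X i j == 0)].
Arguments heis_pred : clear implicits.

Lemma heis_predP (F : fieldType) (n : nat) (X : 'M[F]_n) :
  reflect (forall i j, ~~ heis_pos i j -> X i j = 0) (X \in heis_pred F n).
Proof.
apply: (iffP forallP) => [H i j ij | H i].
  by have /forallP/(_ j)/implyP/(_ ij)/eqP := H i.
by apply/forallP => j; apply/implyP => ij; apply/eqP/H.
Qed.

Lemma heis_submod_closed (F : fieldType) (n : nat) :
  submod_closed (heis_pred F n).
Proof.
split=> [|a X Y /heis_predP HX /heis_predP HY].
  by apply/heis_predP => i j _; rewrite mxE.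
by apply/heis_predP => i j ij; rewrite !mxE HX // HY // mulr0 addr0.
Qed.

HB.instance Definition _ (F : fieldType) (n : nat) :=
  GRing.isSubmodClosed.Build F 'M[F]_n (heis_pred F n)
    (@heis_submod_closed F n).

Record heis (F : fieldType) (n : nat) : Type := Heis {
  heis_val :> 'M[F]_n;
  _ : heis_val \in heis_pred F n
}.

HB.instance Definition _ (F : fieldType) (n : nat) :=
  [isSub for @heis_val F n].
HB.instance Definition _ (F : fieldType) (n : nat) :=
  [Choice of heis F n by <:].
HB.instance Definition _ (F : fieldType) (n : nat) :=
  [SubChoice_isSubLmodule of heis F n by <:].

Definition heis_center (F : fieldType) (n : nat) (Z : heis F n) : Prop :=
  forall X : heis F n, commutator Z X = 0.

Lemma heis_centerP (F : fieldType) (n : nat) (i0 l : 'I_n) (Z : heis F n) :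
  (2 < n)%N -> i0 = 0%N :> nat -> l.+1 = n :> nat ->
  heis_center Z <-> exists a : F, heis_val Z = a *: delta_mx i0 l.
Proof.
move=> n_gt2 i0E lE; have /heis_predP HZ := valP Z.
have il : i0 != l by apply/eqP => /(congr1 val) /= il; rewrite -lE -il i0E in n_gt2.
have e0 (i : 'I_n) : (i == 0%N :> nat) = (i == i0) by rewrite -val_eqE /= i0E.
have el (i : 'I_n) : (i.+1 == n) = (i == l).
  by rewrite -val_eqE -[RHS]eqSS lE.
have posE i j : heis_pos i j = (i == i0) && (j != i0) || (j == l) && (i != l).
  by rewrite /heis_pos !e0 !el.
have dl i j k m : (delta_mx i j : 'M[F]_n) k m = ((k == i) && (m == j))%:R.
  by rewrite mxE.
have dH i j : heis_pos i j -> delta_mx i j \in heis_pred F n.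
  move=> ij; apply/heis_predP => k m; rewrite dl.
  by case: (eqVneq k i) => //= ->; case: (eqVneq m j) => //= ->; rewrite ij.
split=> [cZ | [a Za] X].
  have com i j (ij : heis_pos i j) : commutator Z (delta_mx i j) i0 l = 0.
    by have /= -> := cZ (Heis (dH _ _ ij)); rewrite mxE.
  have comE i j : commutator Z (delta_mx i j) i0 l
      = Z i0 i *+ (l == j) - Z j l *+ (i0 == i).
    rewrite /commutator mxE [X in _ + X]mxE; congr (_ - _); rewrite mxE.
      rewrite (bigD1 i) //= big1 ?addr0 => [|k /negPf ki]; rewrite dl ?ki ?mulr0 //.
      by rewrite eqxx /= mulr_natr.
    rewrite (bigD1 j) //= big1 ?addr0 => [|k /negPf kj]; rewrite dl ?kj ?andbF ?mul0r //.
    by rewrite eqxx andbT /= mulr_natl.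
  exists (Z i0 l); apply/matrixP => i j; rewrite mxE dl.
  have [-> | i_i0] := eqVneq i i0; have [-> | j_l] := eqVneq j l; rewrite ?mulr1 ?mulr0 //=.
    have [-> | j_i0] := eqVneq j i0.
      by apply: HZ; rewrite posE !eqxx /= (negPf il).
    have := com j l; rewrite comE posE !eqxx (negPf j_l) [i0 == j]eq_sym (negPf j_i0) /=.
    by rewrite subr0; apply.
  have [-> | i_l] := eqVneq i l.
    by apply: HZ; rewrite posE !eqxx /= eq_sym (negPf il).
    have := com i0 i; rewrite comE posE !eqxx i_i0 [l == i]eq_sym (negPf i_l) /=.
    by rewrite sub0r => /(_ isT)/eqP; rewrite oppr_eq0 => /eqP.
  by apply: HZ; rewrite posE (negPf i_i0) (negPf j_l).
have /heis_predP HX := valP X.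
rewrite /commutator Za -scalemxAl -scalemxAr -scalerBr.
suff [-> ->] : delta_mx i0 l *m (X : 'M_n) = 0 /\ (X : 'M_n) *m delta_mx i0 l = 0.
  by rewrite subrr scaler0.
split; apply/matrixP => i j; rewrite mxE [RHS]mxE big1 // => k _; rewrite dl.
  have [-> | _] := eqVneq k l; rewrite ?andbF ?mul0r //.
  by rewrite HX ?mulr0 // posE eqxx andbF orbF eq_sym (negPf il).
have [-> | _] := eqVneq k i0; rewrite ?mulr0 //=.
by rewrite HX ?mul0r // posE eqxx andbF /= (negPf il).
Qed.

Definition edge (n : nat) (i : 'I_n) : bool :=
  (i == 0%N :> nat) || (i.+1 == n).

Definition interior_pred (F : fieldType) (n : nat) : {pred 'M[F]_n} :=
  fun A => [forall i, forall j, edge i || edge j ==> (A i j == 0)].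
Arguments interior_pred : clear implicits.

Definition hollow_skew_pred (F : fieldType) (n : nat) : {pred 'M[F]_n} :=
  fun A => [&& A \in interior_pred F n, A == - antitr A
             & [forall i, A i (rev_ord i) == 0]].
Arguments hollow_skew_pred : clear implicits.

(* Main.v *)
From HB Require Import structures.
Require Import Defs.
From mathcomp Require Import all_boot all_order all_algebra.

Import GRing.Theory.
Local Open Scope ring_scope.

(** Write X in the Heisenberg algebra as (x, y, a), where x is the row of
    interior entries of the first row, y the column of interior entries of the
    last column and a the corner entry.  Then [X, X'] is (x y' - x' y) times
    the corner matrix unit, so the commutator is a symplectic form omega on
    H_n / Z(H_n).  Polarizing omega (f X) X = 0 gives
    omega (f X) Y = omega X (f Y) ([commuting_adjoint]): f is self-adjoint for
    omega.  Pairing f X with a matrix unit of the first row or last column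
    reads off one entry of f X, while the adjoint side expresses that entry
    through the entries of X and the images of the matrix units
    ([commuting_first_row], [commuting_last_col]).

    Among pairs of matrix units, self-adjointness says that the block of f from
    x to x and the block from y to y are one and the same matrix A, and that
    the blocks from y to x and from x to y are skew-symmetric; the
    hypothesis on a single matrix unit makes them alternating.  The
    anti-transpose exchanges x and y and reverses their order, so these two
    blocks are the maps X |-> X^tau B and X |-> C X^tau, and reversing one index
    turns an alternating matrix into a hollow skew-persymmetric one.  All these
    products vanish at the corner, so zeta X is the corner entry of f X times
    the corner matrix unit. *)

(** * Entries of Heisenberg and interior matrices *)

Section Heisenberg.
Set Implicit Arguments.
Unset Strict Implicit.
Unset Printing Implicit Defensive.

Variables (F : fieldType) (m : nat).
Local Notation n := m.+2.
Local Notation l := (@ord_max m.+1).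
Implicit Types (X Y : heis F n) (A B : 'M[F]_n) (i j k : 'I_n).

Lemma edgeE i : edge i = (i == ord0) || (i == l).
Proof. by rewrite /edge eqSS. Qed.

Lemma rev_ord0 : rev_ord (ord0 : 'I_n) = l.
Proof. by apply/val_inj; rewrite /= subn1. Qed.

Lemma rev_ord_max : rev_ord l = ord0.
Proof. by apply/val_inj; rewrite /= subnn. Qed.

Lemma edge_rev i : edge (rev_ord i) = edge i.
Proof.
rewrite !edgeE !(can2_eq (@rev_ordK _) (@rev_ordK _)) rev_ord0 rev_ord_max.
exact: orbC.
Qed.

Lemma heis_posE i j :
  heis_pos i j = (i == ord0) && (j != ord0) || (j == l) && (i != l).
Proof. by rewrite /heis_pos !eqSS. Qed.

Lemma heis0 X i j : i != ord0 -> j != l -> X i j = 0.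
Proof.
have /heis_predP HX := valP X => i0 jl.
by apply: HX; rewrite heis_posE (negPf i0) (negPf jl).
Qed.

Lemma heis_first X i : X i ord0 = 0.
Proof.
by have /heis_predP -> := valP X => //; rewrite heis_posE eqxx andbF.
Qed.

Lemma heis_last X j : X l j = 0.
Proof.
by have /heis_predP -> := valP X => //; rewrite heis_posE eqxx andbF.
Qed.

Lemma antitr_heis X : antitr (X : 'M_n) \in heis_pred F n.
Proof.
apply/heis_predP => i j; rewrite heis_posE mxE => ij.
have /heis_predP -> := valP X => //; apply: contra ij.
rewrite heis_posE !(can2_eq (@rev_ordK _) (@rev_ordK _)) rev_ord0 rev_ord_max.
by rewrite orbC.
Qed.

(** Packaged so that the vanishing lemmas about products apply to X^tau too. *)
Definition heis_antitr X := Heis (antitr_heis X).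

Definition interior_part (M : 'I_n -> 'I_n -> F) : 'M[F]_n :=
  \matrix_(i, j) if edge i || edge j then 0 else M i j.

Lemma interior_part_pred M : interior_part M \in interior_pred F n.
Proof.
by apply/forallP=> i; apply/forallP=> j; apply/implyP=> ij; rewrite mxE ij.
Qed.

Lemma interior_part_edge M i j : edge i || edge j -> interior_part M i j = 0.
Proof. by rewrite mxE => ->. Qed.

(** The anti-transpose permutes the interior positions, so only they need to be
    checked; in applications M involves matrix units indexed by i and j, and its
    symmetry can fail at the edges. *)
Lemma interior_part_hollow_skew M :
    (forall i j, ~~ edge i -> ~~ edge j ->
      M i j = - M (rev_ord j) (rev_ord i)) ->
    (forall i, ~~ edge i -> M i (rev_ord i) = 0) ->
  interior_part M \in hollow_skew_pred F n.
Proof.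
move=> skewM hollowM; apply/and3P; split; first exact: interior_part_pred.
  apply/eqP/matrixP=> i j; rewrite !mxE !edge_rev orbC.
  by case: ifPn => [_ | /norP[jN iN]]; [rewrite oppr0 | apply: skewM].
apply/forallP=> i; rewrite mxE edge_rev orbb.
by case: ifPn => // /hollowM ->.
Qed.

(** A row of X other than the first is supported in the last column, which the
    interior matrix kills; hence such a product lives in the first row, and
    symmetrically on the other side in the last column.  This is why each of the
    four products in the decomposition contributes to only one of x and y. *)
Lemma heis_mul_interior X M i j :
  (i != ord0) || edge j -> ((X : 'M_n) *m interior_part M) i j = 0.
Proof.
move=> ij; rewrite mxE big1 // => k _.
case: (boolP (edge k || edge j)) => [kj | ].
  by rewrite interior_part_edge ?mulr0.
rewrite negb_or edgeE negb_or => /andP[/andP[_ kl] jN].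
by rewrite heis0 ?mul0r //; rewrite (negPf jN) orbF in ij.
Qed.

Lemma interior_mul_heis X M i j :
  edge i || (j != l) -> (interior_part M *m (X : 'M_n)) i j = 0.
Proof.
move=> ij; rewrite mxE big1 // => k _.
case: (boolP (edge i || edge k)) => [ik | ].
  by rewrite interior_part_edge ?mul0r.
rewrite negb_or [edge k]edgeE negb_or => /andP[iN /andP[k0 _]].
by rewrite heis0 ?mulr0 //; rewrite (negPf iN) in ij.
Qed.

(** * The symplectic form *)

(** For A and B in the Heisenberg algebra the corner entry is all of [A, B]. *)
Definition omega (A B : 'M[F]_n) : F := commutator A B ord0 l.

Lemma omegaE A B :
  omega A B = \sum_k A ord0 k * B k l - \sum_k B ord0 k * A k l.
Proof. by rewrite /omega /commutator !mxE. Qed.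

Lemma omegaC A B : omega A B = - omega B A.
Proof. by rewrite !omegaE opprB. Qed.

Lemma omegaDl A B C : omega (A + B) C = omega A C + omega B C.
Proof. by rewrite /omega /commutator mulmxDl mulmxDr opprD addrACA mxE. Qed.

Lemma omegaDr A B C : omega A (B + C) = omega A B + omega A C.
Proof. by rewrite omegaC omegaDl opprD -!omegaC. Qed.

(** The only matrix units of the first row and of the last column outside the
    Heisenberg algebra are the diagonal ones; [insubd] sends them to 0. *)
Definition row_unit j : heis F n := insubd 0 (delta_mx ord0 j).
Definition col_unit i : heis F n := insubd 0 (delta_mx i l).

Lemma row_unitE j : j != ord0 -> heis_val (row_unit j) = delta_mx ord0 j.
Proof.
move=> j0; rewrite [LHS]insubdK //; apply/heis_predP => i k.
rewrite heis_posE mxE; have [-> | //] := eqVneq i ord0.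
by have [-> | //] := eqVneq k j; rewrite j0.
Qed.

Lemma col_unitE i : i != l -> heis_val (col_unit i) = delta_mx i l.
Proof.
move=> il; rewrite [LHS]insubdK //; apply/heis_predP => k j.
rewrite heis_posE mxE; have [-> | //] := eqVneq k i.
by have [-> | //] := eqVneq j l; rewrite il orbT.
Qed.

Lemma omega_row_unit X j : j != ord0 -> omega X (row_unit j) = - X j l.
Proof.
move=> j0; rewrite omegaE row_unitE // (bigD1 ord0) //= heis_first mul0r add0r.
rewrite big1 => [|k k0]; last by rewrite mxE (negPf k0) mulr0.
rewrite (bigD1 j) //= mxE !eqxx mul1r big1 ?addr0 ?sub0r // => k kj.
by rewrite mxE (negPf kj) mul0r.
Qed.

Lemma omega_col_unit X i : i != l -> omega X (col_unit i) = X ord0 i.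
Proof.
move=> il; rewrite omegaE col_unitE // (bigD1 i) //= mxE !eqxx mulr1.
rewrite big1 => [|k ki]; last by rewrite mxE (negPf ki) mulr0.
rewrite big1 ?addr0 ?subr0 // => k _; rewrite mxE andbC.
by have [-> | _] := eqVneq k l; rewrite ?heis_last ?mulr0 ?mul0r.
Qed.

(** * Commuting linear maps *)

Variable f : {linear heis F n -> heis F n}.
Hypothesis hf : forall X, commutator (f X) X = 0.

Lemma omega_commuting X : omega (f X) X = 0.
Proof. by rewrite /omega hf mxE. Qed.

(** Polarization of omega (f X) X = 0 at X + Y. *)
Lemma commuting_adjoint X Y : omega (f X) Y = omega X (f Y).
Proof.
have := omega_commuting (X + Y); rewrite linearD /= omegaDl !omegaDr.
rewrite !omega_commuting add0r addr0 => /eqP.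
by rewrite addr_eq0 => /eqP ->; rewrite -omegaC.
Qed.

Lemma row_unit_alt i : i != ord0 -> f (row_unit i) i l = 0.
Proof.
by move=> i0; apply: oppr_inj; rewrite -omega_row_unit // omega_commuting oppr0.
Qed.

Lemma row_unit_skew i j : i != ord0 -> j != ord0 ->
  f (row_unit j) i l = - f (row_unit i) j l.
Proof.
move=> i0 j0; rewrite -omega_row_unit // commuting_adjoint omegaC.
by rewrite omega_row_unit // opprK.
Qed.

Lemma col_unit_alt i : i != l -> f (col_unit i) ord0 i = 0.
Proof. by move=> il; rewrite -omega_col_unit // omega_commuting. Qed.

Lemma col_unit_skew i j : i != l -> j != l ->
  f (col_unit i) ord0 j = - f (col_unit j) ord0 i.
Proof.
move=> il jl; rewrite -omega_col_unit // commuting_adjoint omegaC.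
by rewrite omega_col_unit.
Qed.

Lemma row_unit_col_unit i j : i != ord0 -> j != l ->
  f (row_unit i) ord0 j = f (col_unit j) i l.
Proof.
move=> i0 jl; rewrite -omega_col_unit // commuting_adjoint omegaC.
by rewrite omega_row_unit // opprK.
Qed.

(** This is also the block taking x to the x-part of f X, by
    [row_unit_col_unit]. *)
Definition diag_block := interior_part (fun i j => f (col_unit j) i l).

(** Multiplying by X^tau instead of X reverses the coordinates, whence the
    [rev_ord] on the summation index of each product. *)
Definition col_row_block :=
  interior_part (fun i j => f (col_unit (rev_ord i)) ord0 j).
Definition row_col_block :=
  interior_part (fun i j => f (row_unit (rev_ord j)) i l).

(** Pairing f X with the unit of the last column in row j isolates the entry of
    f X; the adjoint side pairs x with the last column of [f (col_unit j)], minus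
    y with its first row, and skewness of the block from y to x absorbs the
    sign. *)
Lemma commuting_first_row X j : ~~ edge j ->
  f X ord0 j = ((X : 'M_n) *m diag_block) ord0 j
               + (antitr X *m col_row_block) ord0 j.
Proof.
move=> jN; have := jN; rewrite edgeE negb_or => /andP[j0 jl].
rewrite -omega_col_unit // commuting_adjoint omegaE !mxE -sumrN.
congr (_ + _).
  apply: eq_bigr => k _; rewrite mxE (negPf jN) orbF edgeE.
  have [-> | _] := eqVneq k ord0; first by rewrite heis_first !mul0r.
  by have [-> | _] := eqVneq k l; first by rewrite heis_last !mulr0.
rewrite [RHS](reindex_inj rev_ord_inj); apply: eq_bigr => k _.
rewrite !mxE edge_rev (negPf jN) orbF rev_ordK rev_ord0 edgeE.
have [-> | k0] := eqVneq k ord0; first by rewrite heis_first !mul0r mulr0 oppr0.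
have [-> | kl] := eqVneq k l; first by rewrite heis_last !(mulr0, mul0r) oppr0.
by rewrite col_unit_skew // mulNr opprK mulrC.
Qed.

(** The same computation with a unit of the first row; y is now paired with the
    block of f from x to x, and [row_unit_col_unit] replaces it by the block
    from y to y, of which [diag_block] is made. *)
Lemma commuting_last_col X i : ~~ edge i ->
  f X i l = (diag_block *m (X : 'M_n)) i l + (row_col_block *m antitr X) i l.
Proof.
move=> iN; have := iN; rewrite edgeE negb_or => /andP[i0 il].
rewrite -[LHS]opprK -omega_row_unit // commuting_adjoint omegaC opprK.
rewrite omegaE !mxE -sumrN; congr (_ + _).
  apply: eq_bigr => k _; rewrite mxE (negPf iN) edgeE.
  have [-> | k0] := eqVneq k ord0; first by rewrite heis_first !mul0r.
  have [-> | kl] := eqVneq k l; first by rewrite heis_last !mulr0.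
  by rewrite row_unit_col_unit.
rewrite [RHS](reindex_inj rev_ord_inj); apply: eq_bigr => k _.
rewrite !mxE edge_rev (negPf iN) rev_ordK rev_ord_max edgeE.
have [-> | k0] := eqVneq k ord0; first by rewrite heis_first !mul0r oppr0.
have [-> | kl] := eqVneq k l; first by rewrite heis_last !(mulr0, mul0r) oppr0.
by rewrite (@row_unit_skew k i) // mulrN opprK mulrC.
Qed.

Lemma col_row_block_hollow_skew : col_row_block \in hollow_skew_pred F n.
Proof.
apply: interior_part_hollow_skew => [i j | i]; rewrite -(edge_rev i) edgeE.
  case/norP=> _ il; rewrite edgeE => /norP[_ jl].
  by rewrite rev_ordK col_unit_skew.
by case/norP=> _ il; rewrite col_unit_alt.
Qed.

Lemma row_col_block_hollow_skew : row_col_block \in hollow_skew_pred F n.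
Proof.
apply: interior_part_hollow_skew => [i j | i]; rewrite edgeE.
  case/norP=> i0 _; rewrite -(edge_rev j) edgeE => /norP[j0 _].
  by rewrite rev_ordK row_unit_skew.
by case/norP=> i0 _; rewrite rev_ordK row_unit_alt.
Qed.

Lemma corner_in (a : F) : a *: delta_mx ord0 l \in heis_pred F n.
Proof. by rewrite rpredZ // -row_unitE //; apply: valP. Qed.

Definition corner X : heis F n := Heis (corner_in (f X ord0 l)).

Lemma cornerE X i j : corner X i j = f X ord0 l *+ ((i == ord0) && (j == l)).
Proof. by rewrite !mxE mulr_natr. Qed.

Lemma corner_is_zmod_morphism : zmod_morphism corner.
Proof.
move=> X Y; apply/val_inj; rewrite /= linearB /=.
by rewrite -scalerBl !mxE.
Qed.

HB.instance Definition _ :=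
  GRing.isZmodMorphism.Build (heis F n) (heis F n) corner
    corner_is_zmod_morphism.

Lemma commuting_decomposition X :
  f X = anticommutator X diag_block + antitr X *m col_row_block
        + row_col_block *m antitr X + corner X :> 'M[F]_n.
Proof.
have XtE : antitr X = heis_antitr X by [].
(* Group the products supported in the first row, then those supported in the
   last column. *)
have sumE (M1 M2 M3 M4 M5 : 'M[F]_n) i j :
    (M1 + M2 + M3 + M4 + M5) i j
    = M1 i j + M3 i j + (M2 i j + M4 i j) + M5 i j.
  by rewrite !mxE; congr (_ + _); rewrite [RHS]addrACA !addrA.
apply/matrixP => i j; rewrite /anticommutator sumE XtE.
have [-> | i0] := eqVneq i ord0; last first.
  rewrite !(@heis_mul_interior _ _ i) ?i0 // add0r.
  have [-> | jl] := eqVneq j l; last first.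
    rewrite !interior_mul_heis ?jl ?orbT // heis0 //.
    by rewrite heis0 // !addr0.
  have [-> | il] := eqVneq i l.
    by rewrite !interior_mul_heis ?edgeE ?eqxx ?orbT // !heis_last !addr0.
  have iN : ~~ edge i by rewrite edgeE negb_or i0.
  by rewrite commuting_last_col // cornerE (negPf i0) addr0 add0r.
rewrite !interior_mul_heis ?edgeE ?eqxx // !addr0.
have [jE | jN] := boolP (edge j).
  rewrite !heis_mul_interior ?jE ?orbT // !add0r.
  move: jE; rewrite edgeE => /orP[] /eqP ->; first by rewrite !heis_first.
  by rewrite cornerE !eqxx.
rewrite commuting_first_row // cornerE eqxx andTb.
by move: jN; rewrite edgeE => /norP[_ /negPf->]; rewrite addr0.
Qed.
End Heisenberg.

Theorem theorem1p2 (F : fieldType) (n : nat) (hn : (3 <= n)%N)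
    (hF : [pchar F] =i pred0)
    (f : {linear heis F n -> heis F n})
    (hf : forall X : heis F n, commutator (f X) X = 0) :
  exists (A B C : 'M[F]_n) (zeta : {additive heis F n -> heis F n}),
    [/\ A \in interior_pred F n,
        B \in hollow_skew_pred F n,
        C \in hollow_skew_pred F n,
        forall X : heis F n, heis_center (zeta X)
      & forall X : heis F n,
          f X = anticommutator X A + antitr X *m B + C *m antitr X + zeta X
            :> 'M[F]_n].
Proof.
case: n hn f hf => [|[|m]] // hn f hf.
exists (diag_block f), (col_row_block f), (row_col_block f), (corner f).
split.
- exact: interior_part_pred.
- exact: col_row_block_hollow_skew.
- exact: row_col_block_hollow_skew.
- move=> X; apply/(@heis_centerP _ _ ord0 ord_max) => //.
  by exists (f X ord0 ord_max).
- exact: commuting_decomposition.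
Qed.
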